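(* (Subject reduction.) Let $\Gamma \vdash M: C$ be a type assignment derivable in $\mathsf{ND}_{\mathsf{CK}}$. If $M\rightsquigarrow_{\beta\eta\kappa} N$, then $\Gamma \vdash N: C$ is derivable in $\mathsf{ND}_{\mathsf{CK}}$.
   Context: Types: $A ::= a \mid (A\to A) \mid \Box A$ ($a$ atoms). Modal $\lambda$-terms: $M,N ::= x \mid \lambda x.M \mid MN \mid M[N_1,\ldots,N_n/x_1,\ldots,x_n]$ (explicit substitution; $x_1,\ldots,x_n$ distinct and bound in $M$), modulo $\alpha$-equivalence (Barendregt convention) and simultaneous permutation of the pairs $N_i/x_i$. Vectors $\vec P$ abbreviate lists of terms/variables. $FV(x)=\{x\}$, $FV(\lambda x.N)=FV(N)\setminus\{x\}$, $FV(NP)=FV(N)\cup FV(P)$, $FV(N[\vec P/\vec x])=\bigcup_i FV(P_i)$; $M\{N/x\}$ is capture-avoiding substitution. Contexts are lists of declarations $x:A$ with distinct variables. System $\mathsf{ND}_{\mathsf{CK}}$: (Id) $x_1:A_1,\ldots,x_n:A_n\vdash x_i:A_i$; (Abs) from $\Gamma,x:A\vdash M:C$ infer $\Gamma\vdash\lambda x.M:A\to C$; (App) from $\Gamma\vdash N:A$ and $\Gamma\vdash M:A\to C$ infer $\Gamma\vdash MN:C$; ($\Box$-subst) from $\Gamma\vdash N_i:\Box A_i$ ($i=1..n$) and $x_1:A_1,\ldots,x_n:A_n\vdash M:C$ infer $\Gamma\vdash M[N_1,\ldots,N_n/x_1,\ldots,x_n]:\Box C$, with $x_1,\ldots,x_n$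 not occurring in $\Gamma$. $\Lambda$ is the set of terms having a derivable type assignment; $\Lambda^\lambda$ (resp. $\Lambda^\Box$) the $\lambda$-abstractions (resp. explicit substitutions) in $\Lambda$. Ground steps: ($\beta_1$) $(\lambda x.M)N \to M\{N/x\}$; ($\beta_2$) $M[\vec P, R[\vec N/\vec z], \vec Q/\vec x, y, \vec w] \to (M\{R/y\})[\vec P,\vec N,\vec Q/\vec x,\vec z,\vec w]$; ($\eta_1$) $M\to \lambda x.Mx$ if $\Gamma\vdash M:A\to B$ is derivable, $x\notin FV(M)$ and $M\notin\Lambda^\lambda$; ($\eta_2$) $M\to x[M/x]$ if $\Gamma\vdash M:\Box A$ is derivable, $x\notin FV(M)$ and $M\notin\Lambda^\Box$; ($\kappa_1$) $M[\vec P,N,\vec Q/\vec x,y,\vec z]\to M[\vec P,\vec Q/\vec x,\vec z]$ if $y$ has no free occurrence in $M$; ($\kappa_2$) $M[\vec P,N,N,\vec Q/\vec x,y_1,y_2,\vec z]\to (M\{v,v/y_1,y_2\})[\vec P,N,\vec Q/\vec x,v,\vec z]$ with $v$ fresh. Terms with a hole: $\mathsf C ::= \circ \mid \lambda x.\mathsf C \mid M\mathsf C \mid \mathsf C M \mid \mathsf C[\vec M/\vec x] \mid M[\vec N_1,\mathsf C,\vec N_2/\vec x_1,x,\vec x_2]$; $\mathsf E ::= \circ \mid \lambda x.\mathsf E \mid M\mathsf E \mid \mathsf E' M \mid \mathsf E[\vec M/\vec x] \mid M[\vec N_1,\mathsf E,\vec N_2/\vec x_1,x,\vec x_2]$ where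 $\mathsf E'$ is such a context different from $\circ$; $\mathsf D ::= \circ \mid \lambda x.\mathsf D \mid M\mathsf D \mid \mathsf D M \mid \mathsf D[\vec M/\vec x] \mid M[\vec N_1,\mathsf D',\vec N_2/\vec x_1,x,\vec x_2]$ where $\mathsf D'\neq\circ$. $\mathsf C\langle M\rangle$ is the result of replacing $\circ$ by $M$. Then $\mathsf C\langle M\rangle\rightsquigarrow_\beta\mathsf C\langle N\rangle$ (resp. $\rightsquigarrow_\kappa$) for every $\mathsf C$ if $M\to N$ by $\beta_1$ or $\beta_2$ (resp. $\kappa_1$ or $\kappa_2$); $\mathsf E\langle M\rangle\rightsquigarrow_\eta\mathsf E\langle N\rangle$ if $M\to N$ by $\eta_1$; $\mathsf D\langle M\rangle\rightsquigarrow_\eta\mathsf D\langle N\rangle$ if $M\to N$ by $\eta_2$. Finally $\rightsquigarrow_{\beta\eta\kappa}=\rightsquigarrow_\beta\cup\rightsquigarrow_\eta\cup\rightsquigarrow_\kappa$.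
   Formalization: λ-abstractions carry the type of their bound variable, and the Γ in η1 and η2 is the context in which the redex occurs; for unannotated terms the claim fails, e.g. κ2 on (λf. f y1 y2)[N,N/y1,y2] with N=(λz.z)[], whose two copies can have different types. *)

(* Defs.v *)
From Stdlib Require Import List Arith Relations.
Import ListNotations.

Inductive type : Set :=
| Atom (a : nat)
| Arrow (A B : type)
| Box (A : type).

(** De Bruijn terms, so that alpha-equivalent terms are equal.
    - [Lam A M] is [lambda x. M]: in [M] the index 0 is [x] and [S i] is the
      outer variable [i].  The bound variable carries its type [A] (Church
      style).  Over unannotated terms subject reduction is false: for instance
      [(lambda z. z)[]] has both types [Box (a -> a)] and [Box (b -> b)], so in
      a typed term [M[N, N / y1, y2]] the two copies of [N] may have different
      types, and then they cannot be contracted by kappa2; similarly, the eta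
      steps need the type of the redex to be determined.
    - [Sub M [N_1; ...; N_n]] is [M[N_1, ..., N_n / x_1, ..., x_n]]: the body
      [M] lives in its own scope, where the index [i < n] is the variable bound
      to the [i]-th item of the list (counting from 0).  Outer variables are
      not visible in [M]. *)
Inductive term : Set :=
| Var (i : nat)
| Lam (A : type) (M : term)
| App (M N : term)
| Sub (M : term) (Ns : list term).

Inductive FV : term -> nat -> Prop :=
| FV_Var i : FV (Var i) i
| FV_Lam A N i : FV N (S i) -> FV (Lam A N) i
| FV_App_l N P i : FV N i -> FV (App N P) i
| FV_App_r N P i : FV P i -> FV (App N P) i
| FV_Sub N Ps P i : In P Ps -> FV P i -> FV (Sub N Ps) i.

Definition up_ren (r : nat -> nat) (i : nat) : nat :=
  match i with 0 => 0 | S j => S (r j) end.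

Fixpoint rename (r : nat -> nat) (M : term) : term :=
  match M with
  | Var i => Var (r i)
  | Lam A N => Lam A (rename (up_ren r) N)
  | App N P => App (rename r N) (rename r P)
  | Sub N Ps => Sub N (map (rename r) Ps)
  end.

Definition up (s : nat -> term) (i : nat) : term :=
  match i with 0 => Var 0 | S j => rename S (s j) end.

(** Capture-avoiding simultaneous substitution. *)
Fixpoint subst (s : nat -> term) (M : term) : term :=
  match M with
  | Var i => s i
  | Lam A N => Lam A (subst (up s) N)
  | App N P => App (subst s N) (subst s P)
  | Sub N Ps => Sub N (map (subst s) Ps)
  end.

(** The [i]-th item of a context is the type declared for the variable [i]. *)
Definition context : Set := list type.

Inductive typed : context -> term -> type -> Prop :=
| T_Id G i A :
    nth_error G i = Some A ->
    typed G (Var i) A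
| T_Abs G A M C :
    typed (A :: G) M C ->
    typed G (Lam A M) (Arrow A C)
| T_App G M N A C :
    typed G N A ->
    typed G M (Arrow A C) ->
    typed G (App M N) C
| T_BoxSubst G M Ns As C :
    Forall2 (fun N A => typed G N (Box A)) Ns As ->
    typed As M C ->
    typed G (Sub M Ns) (Box C).

Definition Lambda (M : term) : Prop := exists G A, typed G M A.

Definition Lambda_lam (M : term) : Prop :=
  Lambda M /\ exists A N, M = Lam A N.

Definition Lambda_box (M : term) : Prop :=
  Lambda M /\ exists N Ps, M = Sub N Ps.

Definition subst1 (N : term) (i : nat) : term :=
  match i with 0 => N | S j => Var j end.

(** [M{R/y}] in beta2, where [y] has index [p] in [M] and [R] binds [n]
    variables: the variables before [y] keep their index, those of [R] are moved
    to [p, ..., p + n - 1], and those after [y] are moved past them. *)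
Definition flatten_subst (p n : nat) (R : term) (i : nat) : term :=
  if i <? p then Var i
  else if i =? p then rename (Nat.add p) R
  else Var (i - 1 + n).

(** Sends both [p] and [p + 1] to [p] and renumbers the variables after them. *)
Definition merge (p i : nat) : nat := if i <=? p then i else i - 1.

(** Renumbers the variables after [p] when [p], which does not occur, is
    removed. *)
Definition skip (p i : nat) : nat := if i <? p then i else i - 1.

Inductive beta : term -> term -> Prop :=
| beta1 A M N :
    beta (App (Lam A M) N) (subst (subst1 N) M)
| beta2 M Ps R Ns Qs :
    beta (Sub M (Ps ++ Sub R Ns :: Qs))
         (Sub (subst (flatten_subst (length Ps) (length Ns) R) M)
              (Ps ++ Ns ++ Qs)).

(** The eta steps depend on the context [G] in which the redex is typed.
    Renaming [M] by [S] makes the variable of index 0 fresh for [M]. *)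
Inductive eta1 (G : context) : term -> term -> Prop :=
| eta1_intro M A B :
    typed G M (Arrow A B) ->
    ~ Lambda_lam M ->
    eta1 G M (Lam A (App (rename S M) (Var 0))).

(** No renaming is needed here: [M] is outside the scope of the bound
    variable. *)
Inductive eta2 (G : context) : term -> term -> Prop :=
| eta2_intro M A :
    typed G M (Box A) ->
    ~ Lambda_box M ->
    eta2 G M (Sub (Var 0) [M]).

Inductive kappa : term -> term -> Prop :=
| kappa1 M Ps N Qs :
    ~ FV M (length Ps) ->
    kappa (Sub M (Ps ++ N :: Qs))
          (Sub (rename (skip (length Ps)) M) (Ps ++ Qs))
| kappa2 M Ps N Qs :
    kappa (Sub M (Ps ++ N :: N :: Qs))
          (Sub (rename (merge (length Ps)) M) (Ps ++ N :: Qs)).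

(** Terms with a hole (the contexts [C]). *)
Inductive hterm : Set :=
| Hole
| HLam (A : type) (C : hterm)
| HAppR (M : term) (C : hterm)
| HAppL (C : hterm) (M : term)
| HSubBody (C : hterm) (Ms : list term)
| HSubArg (M : term) (Ns1 : list term) (C : hterm) (Ns2 : list term).

Inductive is_E : hterm -> Prop :=
| E_Hole : is_E Hole
| E_Lam A E : is_E E -> is_E (HLam A E)
| E_AppR M E : is_E E -> is_E (HAppR M E)
| E_AppL E M : is_E E -> E <> Hole -> is_E (HAppL E M)
| E_SubBody E Ms : is_E E -> is_E (HSubBody E Ms)
| E_SubArg M Ns1 E Ns2 : is_E E -> is_E (HSubArg M Ns1 E Ns2).

Inductive is_D : hterm -> Prop :=
| D_Hole : is_D Hole
| D_Lam A D : is_D D -> is_D (HLam A D)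
| D_AppR M D : is_D D -> is_D (HAppR M D)
| D_AppL D M : is_D D -> is_D (HAppL D M)
| D_SubBody D Ms : is_D D -> is_D (HSubBody D Ms)
| D_SubArg M Ns1 D Ns2 : is_D D -> D <> Hole -> is_D (HSubArg M Ns1 D Ns2).

Fixpoint plug (C : hterm) (M : term) : term :=
  match C with
  | Hole => M
  | HLam A C => Lam A (plug C M)
  | HAppR N C => App N (plug C M)
  | HAppL C N => App (plug C M) N
  | HSubBody C Ns => Sub (plug C M) Ns
  | HSubArg N Ns1 C Ns2 => Sub N (Ns1 ++ plug C M :: Ns2)
  end.

(** [hole_context G C D]: when the whole term is in context [G], the hole of
    [C] is in context [D].  The body of an explicit substitution is typed in
    the context given by the types of the substituted terms. *)
Inductive hole_context : context -> hterm -> context -> Prop :=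
| hc_Hole G : hole_context G Hole G
| hc_Lam G A C D : hole_context (A :: G) C D -> hole_context G (HLam A C) D
| hc_AppR G M C D : hole_context G C D -> hole_context G (HAppR M C) D
| hc_AppL G C M D : hole_context G C D -> hole_context G (HAppL C M) D
| hc_SubBody G C Ms As D :
    Forall2 (fun M A => typed G M (Box A)) Ms As ->
    hole_context As C D ->
    hole_context G (HSubBody C Ms) D
| hc_SubArg G M Ns1 C Ns2 D :
    hole_context G C D -> hole_context G (HSubArg M Ns1 C Ns2) D.

Inductive hclosure (R : term -> term -> Prop) : term -> term -> Prop :=
| hclosure_intro C M N : R M N -> hclosure R (plug C M) (plug C N).

Definition swap (p i : nat) : nat :=
  if i =? p then S p else if i =? S p then p else i.

(** Adjacent transpositions generate all simultaneous permutations of the pairs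
    [N_i/x_i]. *)
Inductive transpose : term -> term -> Prop :=
| transpose_intro M Ps N1 N2 Qs :
    transpose (Sub M (Ps ++ N1 :: N2 :: Qs))
              (Sub (rename (swap (length Ps)) M) (Ps ++ N2 :: N1 :: Qs)).

(** The congruence by which terms are identified. *)
Definition perm_equiv : term -> term -> Prop :=
  clos_refl_sym_trans term (hclosure transpose).

(** A step between equivalence classes is a step between some
    representatives. *)
Definition modulo_perm (R : term -> term -> Prop) (M N : term) : Prop :=
  exists M' N', perm_equiv M M' /\ R M' N' /\ perm_equiv N' N.

Definition red_beta : term -> term -> Prop := modulo_perm (hclosure beta).

Definition red_kappa : term -> term -> Prop := modulo_perm (hclosure kappa).

Inductive eta_closure (G : context) : term -> term -> Prop :=
| eta_closure1 E D M N :
    is_E E -> hole_context G E D -> eta1 D M N ->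
    eta_closure G (plug E M) (plug E N)
| eta_closure2 C D M N :
    is_D C -> hole_context G C D -> eta2 D M N ->
    eta_closure G (plug C M) (plug C N).

Definition red_eta (G : context) : term -> term -> Prop :=
  modulo_perm (eta_closure G).

Definition red (G : context) (M N : term) : Prop :=
  red_beta M N \/ red_eta G M N \/ red_kappa M N.

(* Main.v *)
(** The hole of a term context is typed in a context that only depends on the
    surrounding term, so it suffices that each ground step preserves types; this
    follows from stability of typing under renaming and substitution.  Since
    abstractions are annotated, types are unique: this gives the two copies of
    [N] in a kappa2 redex the same type, and identifies the type at which an eta
    redex is expanded with its type in the surrounding derivation.
    Transpositions of explicit substitutions preserve typing in both directions
    because [transpose] is symmetric. *)

From Stdlib Require Import List Arith Relations Lia.
Import ListNotations.
Require Import Defs.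

#[local] Hint Constructors FV hole_context : core.

(** * Nested induction and uniqueness of types *)

Lemma term_nested_ind (P : term -> Prop)
  (HVar : forall i, P (Var i))
  (HLam : forall A M, P M -> P (Lam A M))
  (HApp : forall M N, P M -> P N -> P (App M N))
  (HSub : forall M Ns, P M -> Forall P Ns -> P (Sub M Ns)) :
  forall M, P M.
Proof.
  fix IH 1; intros [i | A M | M N | M Ns].
  - apply HVar.
  - apply HLam, IH.
  - apply HApp; apply IH.
  - apply HSub; [apply IH |].
    induction Ns; constructor; [apply IH | assumption].
Qed.

(** The automatically generated principle has no hypothesis on the items of
    an explicit substitution. *)
Lemma typed_nested_ind (P : context -> term -> type -> Prop)
  (HId : forall G i A, nth_error G i = Some A -> P G (Var i) A)
  (HAbs : forall G A M C, P (A :: G) M C -> P G (Lam A M) (Arrow A C))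
  (HApp : forall G M N A C, P G N A -> P G M (Arrow A C) -> P G (App M N) C)
  (HBox : forall G M Ns As C,
      Forall2 (fun N A => P G N (Box A)) Ns As -> typed As M C ->
      P As M C -> P G (Sub M Ns) (Box C)) :
  forall G M A, typed G M A -> P G M A.
Proof.
  fix IH 4; intros G M A [G' i A' Hi | G' A' M' C' HM | G' M' N' A' C' HN HM
                         | G' M' Ns As C' HNs HM].
  - apply HId, Hi.
  - apply HAbs, IH, HM.
  - apply HApp with A'; apply IH; assumption.
  - apply HBox with As; [| exact HM | apply IH, HM].
    clear HM; induction HNs; constructor; [apply IH |]; assumption.
Qed.

(** For [Sub], the induction hypotheses on the items force both derivations to type the body in the
    same context, so the hypothesis on the body applies. *)
Lemma typed_unique G M A B : typed G M A -> typed G M B -> A = B.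
Proof.
  intros HA; revert B; induction HA as [G i A Hi | G A M C IH | G M N A C _ IH
    | G M Ns As C HNs _ IH] using typed_nested_ind; intros B HB; inversion HB; subst.
  - congruence.
  - f_equal; auto.
  - match goal with H : typed G M _ |- _ => apply IH in H end; congruence.
  - match goal with H : Forall2 _ Ns ?Bs |- _ =>
      enough (As = Bs) by (subst; f_equal; auto);
      clear - H HNs; revert Bs H
    end.
    induction HNs as [| N A Ns As HN _ IHNs]; intros Bs H; inversion H; subst;
      [reflexivity |].
    f_equal; auto.
    match goal with H : typed G N _ |- _ => apply HN in H; congruence end.
Qed.

Lemma Forall2_typed_unique G Ns As Bs :
  Forall2 (fun N A => typed G N (Box A)) Ns As ->
  Forall2 (fun N A => typed G N (Box A)) Ns Bs -> As = Bs.
Proof.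
  intros HA; revert Bs; induction HA as [| N A Ns As HN _ IH]; intros Bs HB;
    inversion HB; subst; [reflexivity |].
  f_equal; auto.
  match goal with H : typed G N _ |- _ =>
    pose proof (typed_unique _ _ _ _ HN H); congruence end.
Qed.

(** * Renaming and substitution *)

(** Restricting the condition on [r] to free variables serves [kappa1]: the discarded variable has
    no slot of its type in the smaller context. *)
Lemma typed_rename G M A G' r :
  typed G M A ->
  (forall i B, FV M i -> nth_error G i = Some B -> nth_error G' (r i) = Some B) ->
  typed G' (rename r M) A.
Proof.
  intros HM; revert G' r; induction HM as [G i A Hi | G A M C IH
    | G M N A C IHN IHM | G M Ns As C HNs HM _] using typed_nested_ind;
    intros G' r Hr; simpl.
  - constructor; apply Hr; [constructor | assumption].
  - constructor; apply IH; intros [| i] B Hi HB; simpl in *; auto.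
  - econstructor; [apply IHN | apply IHM]; intros; apply Hr; auto.
  - apply T_BoxSubst with As; [| assumption].
    assert (Hr' : forall N, In N Ns -> forall i B, FV N i ->
      nth_error G i = Some B -> nth_error G' (r i) = Some B)
      by (intros; apply Hr; eauto).
    clear - HNs Hr'; induction HNs; simpl; constructor; eauto with datatypes.
Qed.

Lemma typed_subst G M A G' s :
  typed G M A ->
  (forall i B, nth_error G i = Some B -> typed G' (s i) B) ->
  typed G' (subst s M) A.
Proof.
  intros HM; revert G' s; induction HM as [G i A Hi | G A M C IH
    | G M N A C IHN IHM | G M Ns As C HNs HM _] using typed_nested_ind;
    intros G' s Hs; simpl.
  - auto.
  - constructor; apply IH; intros [| i] B HB; simpl in *.
    + constructor; assumption.
    + apply typed_rename with G'; auto.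
  - econstructor; eauto.
  - apply T_BoxSubst with As; [| assumption].
    clear - HNs Hs; induction HNs; simpl; constructor; auto.
Qed.

Lemma rename_cancel r r' M : (forall i, r' (r i) = i) -> rename r' (rename r M) = M.
Proof.
  revert r r'; induction M as [i | A M IH | M N IHM IHN | M Ns _ IHNs]
    using term_nested_ind; intros r r' Hr; simpl; f_equal; auto.
  - apply IH; intros [| i]; simpl; auto.
  - rewrite map_map.
    induction IHNs; simpl; f_equal; auto.
Qed.

Lemma transpose_sym M N : transpose M N -> transpose N M.
Proof.
  intros [M' Ps N1 N2 Qs].
  (* [swap] is an involution, so the target body can be written as the swap of the source body, as
     [transpose_intro] requires. *)
  rewrite <- (rename_cancel (swap (length Ps)) (swap (length Ps)) M') at 2.
  - constructor.
  - intros i; unfold swap.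
    destruct (Nat.eqb_spec i (length Ps)), (Nat.eqb_spec i (S (length Ps)));
      repeat match goal with
             | |- context [?a =? ?b] => destruct (Nat.eqb_spec a b)
             end; lia.
Qed.

(** * Preservation of types by transpositions and ground steps *)

Lemma nth_error_app_case {T} (l l' : list T) i :
  nth_error (l ++ l') i =
  if i <? length l then nth_error l i else nth_error l' (i - length l).
Proof.
  destruct (Nat.ltb_spec i (length l));
    [apply nth_error_app1 | apply nth_error_app2]; assumption.
Qed.

Lemma typed_transpose G M N A : transpose M N -> typed G M A -> typed G N A.
Proof.
  intros [M' Ps N1 N2 Qs] HM; inversion HM as [| | | ? ? ? As C HNs HM']; subst.
  apply Forall2_app_inv_l in HNs as (As1 & As' & H1 & H' & ->).
  inversion H' as [| ? A1 ? ? HN1 H'']; subst.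
  inversion H'' as [| ? A2 ? As2 HN2 H2]; subst.
  apply T_BoxSubst with (As1 ++ A2 :: A1 :: As2).
  - apply Forall2_app; auto.
  - apply typed_rename with (1 := HM'); intros i B _ HB.
    rewrite (Forall2_length H1); rewrite nth_error_app_case in *; unfold swap.
    destruct (Nat.eqb_spec i (length As1)) as [-> |];
      [| destruct (Nat.eqb_spec i (S (length As1))) as [-> |]].
    + rewrite Nat.ltb_irrefl, Nat.sub_diag in HB.
      destruct (Nat.ltb_spec (S (length As1)) (length As1)); [lia |].
      now replace (S (length As1) - length As1) with 1 by lia.
    + rewrite Nat.ltb_irrefl, Nat.sub_diag.
      destruct (Nat.ltb_spec (S (length As1)) (length As1)); [lia |].
      now replace (S (length As1) - length As1) with 1 in HB by lia.
    + destruct (Nat.ltb_spec i (length As1)); [assumption |].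
      now destruct (i - length As1) as [| [| k]] eqn:?; [lia | lia |].
Qed.

Lemma typed_beta G M N A : beta M N -> typed G M A -> typed G N A.
Proof.
  intros [B M' N' | M' Ps R Ns Qs] HM.
  - inversion HM as [| | ? ? ? A' ? HN' HL |]; subst.
    inversion HL as [| ? ? ? ? HM' | |]; subst.
    apply typed_subst with (1 := HM'); intros [| i] D HD; simpl in *.
    + congruence.
    + constructor; assumption.
  - inversion HM as [| | | ? ? ? As C HNs HM']; subst.
    apply Forall2_app_inv_l in HNs as (As1 & As' & H1 & H' & ->).
    inversion H' as [| ? B ? As2 HR H2]; subst.
    inversion HR as [| | | ? ? ? Bs ? HNs HR']; subst.
    (* The block [Bs] that types the body [R] takes the place of the single entry [B] of the
       contracted variable. *)
    apply T_BoxSubst with (As1 ++ Bs ++ As2).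
    + auto using Forall2_app.
    + rewrite (Forall2_length H1), (Forall2_length HNs).
      apply typed_subst with (1 := HM'); intros i D HD; unfold flatten_subst.
      rewrite nth_error_app_case in HD.
      destruct (Nat.ltb_spec i (length As1)).
      { constructor; now rewrite nth_error_app1. }
      destruct (Nat.eqb_spec i (length As1)) as [-> |].
      * rewrite Nat.sub_diag in HD; injection HD as <-.
        (* Shifting by [length As1] moves the variables of [R] exactly onto the block [Bs]. *)
        apply typed_rename with (1 := HR'); intros j E _ HE.
        rewrite nth_error_app2 by lia.
        replace (length As1 + j - length As1) with j by lia.
        rewrite nth_error_app1; [assumption |].
        apply nth_error_Some; congruence.
      * constructor; rewrite !nth_error_app2 by lia.
        replace (i - length As1) with (S (i - 1 - length As1)) in HD by lia.
        now replace (i - 1 + length Bs - length As1 - length Bs)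
          with (i - 1 - length As1) by lia.
Qed.

Lemma typed_kappa G M N A : kappa M N -> typed G M A -> typed G N A.
Proof.
  intros [M' Ps N' Qs Hfree | M' Ps N' Qs] HM;
    inversion HM as [| | | ? ? ? As C HNs HM']; subst;
    apply Forall2_app_inv_l in HNs as (As1 & As' & H1 & H' & ->).
  - inversion H' as [| ? B ? As2 HN' H2]; subst.
    apply T_BoxSubst with (As1 ++ As2); [auto using Forall2_app |].
    rewrite (Forall2_length H1) in *.
    apply typed_rename with (1 := HM'); intros i D HFV HD; unfold skip.
    (* At the removed index [skip] returns a meaningless value, but that index is not free in
       [M']. *)
    destruct (Nat.eq_dec i (length As1)) as [-> |]; [contradiction |].
    rewrite nth_error_app_case in HD.
    destruct (Nat.ltb_spec i (length As1)).
    + now rewrite nth_error_app1.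
    + rewrite nth_error_app2 by lia.
      now replace (i - length As1) with (S (i - 1 - length As1)) in HD by lia.
  - inversion H' as [| ? B1 ? ? HN1 H'']; subst.
    inversion H'' as [| ? B2 ? As2 HN2 H2]; subst.
    assert (B1 = B2) as <- by (pose proof (typed_unique _ _ _ _ HN1 HN2); congruence).
    apply T_BoxSubst with (As1 ++ B1 :: As2); [auto using Forall2_app |].
    rewrite (Forall2_length H1).
    apply typed_rename with (1 := HM'); intros i D _ HD; unfold merge.
    rewrite nth_error_app_case in *.
    destruct (Nat.ltb_spec i (length As1)), (Nat.leb_spec i (length As1)); try lia.
    + now destruct (Nat.ltb_spec i (length As1)); [| lia].
    + replace i with (length As1) in * by lia.
      rewrite Nat.ltb_irrefl; now rewrite Nat.sub_diag in *.
    (* This covers the second merged variable, whose type is that of the first because [B1 = B2],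
       and all later ones; each moves down by one. *)
    + destruct (Nat.ltb_spec (i - 1) (length As1)); [lia |].
      replace (i - length As1) with (S (i - 1 - length As1)) in HD by lia.
      now destruct (i - 1 - length As1).
Qed.

Lemma typed_eta1 G M N A : eta1 G M N -> typed G M A -> typed G N A.
Proof.
  intros [M' B C HM' _] HM; rewrite (typed_unique _ _ _ _ HM HM').
  constructor; apply T_App with B.
  - now constructor.
  - apply typed_rename with (1 := HM'); auto.
Qed.

Lemma typed_eta2 G M N A : eta2 G M N -> typed G M A -> typed G N A.
Proof.
  intros [M' B HM' _] HM; rewrite (typed_unique _ _ _ _ HM HM').
  apply T_BoxSubst with [B]; [auto | now constructor].
Qed.

(** * Contexts with a hole and permutation classes *)

(** Unlike [eta_closure], [hclosure] records no typing context for the hole; one is read off from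
    the derivation of the plugged term. *)
Lemma typed_plug_hole_context G C M A :
  typed G (plug C M) A -> exists D, hole_context G C D.
Proof.
  revert G A; induction C as [| B C IH | P C IH | C IH P | C IH Ps | P Ns1 C IH Ns2];
    simpl; intros G A HM; [eexists; constructor | ..];
    inversion HM as [| ? ? ? ? H | ? ? ? ? ? HN H | ? ? ? As ? HNs H]; subst.
  - apply IH in H as [D HD]; eauto.
  - apply IH in HN as [D HD]; eauto.
  - apply IH in H as [D HD]; eauto.
  - apply IH in H as [D HD]; eauto.
  - apply Forall2_app_inv_l in HNs as (As1 & As' & _ & H' & _).
    inversion H' as [| ? B ? ? HN _]; subst.
    apply IH in HN as [D HD]; eauto.
Qed.

(** The type of the hole is left to the derivation, hence the quantification over [B]; its context
    must be [D], by uniqueness of types. *)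
Lemma typed_plug_replace G C D M N A :
  hole_context G C D ->
  (forall B, typed D M B -> typed D N B) ->
  typed G (plug C M) A -> typed G (plug C N) A.
Proof.
  intros HC HMN; revert A; induction HC as [| | | | G C Ps Bs D HPs HC IH |];
    simpl; intros T HT; [auto | ..];
    inversion HT as [| ? ? ? ? H | ? ? ? ? ? HN H | ? ? ? As ? HNs H]; subst.
  - constructor; auto.
  - econstructor; eauto.
  - econstructor; eauto.
  (* The context of the body found by inversion is the one recorded in [hole_context]. *)
  - rewrite (Forall2_typed_unique _ _ _ _ HNs HPs) in H.
    apply T_BoxSubst with Bs; auto.
  - apply Forall2_app_inv_l in HNs as (As1 & As' & H1 & H' & ->).
    inversion H'; subst.
    econstructor; eauto using Forall2_app.
Qed.

Lemma typed_hclosure (R : term -> term -> Prop)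
  (HR : forall G M N A, R M N -> typed G M A -> typed G N A) G M N A :
  hclosure R M N -> typed G M A -> typed G N A.
Proof.
  intros [C M' N' HMN] HM.
  destruct (typed_plug_hole_context _ _ _ _ HM) as [D HD].
  apply typed_plug_replace with (1 := HD) (3 := HM); eauto.
Qed.

(** Stated as an equivalence so that the reflexive, symmetric and transitive cases are purely
    propositional. *)
Lemma typed_perm_equiv G M N A : perm_equiv M N -> typed G M A <-> typed G N A.
Proof.
  induction 1 as [M N HMN | | | M N P _ IH1 _ IH2]; [| tauto ..].
  split; apply (typed_hclosure _ typed_transpose); [assumption |].
  destruct HMN; constructor; now apply transpose_sym.
Qed.

(** [G] is fixed in [HR] because the relation may itself depend on it, as [eta_closure G] does. *)
Lemma typed_modulo_perm (R : term -> term -> Prop) G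
  (HR : forall M N A, R M N -> typed G M A -> typed G N A) M N A :
  modulo_perm R M N -> typed G M A -> typed G N A.
Proof.
  intros (M' & N' & HM & HMN & HN) H.
  apply (typed_perm_equiv _ _ _ _ HN), (HR _ _ _ HMN), (typed_perm_equiv _ _ _ _ HM), H.
Qed.

Lemma typed_eta_closure G M N A : eta_closure G M N -> typed G M A -> typed G N A.
Proof.
  intros [C D M' N' _ HC HMN | C D M' N' _ HC HMN];
    apply typed_plug_replace with (1 := HC); eauto using typed_eta1, typed_eta2.
Qed.

Theorem theorem3p6 (G : context) (M N : term) (C : type)
  (HM : typed G M C) (Hred : red G M N) :
  typed G N C.
Proof.
  destruct Hred as [H | [H | H]]; revert H HM; apply typed_modulo_perm.
  - exact (typed_hclosure _ typed_beta G).
  - exact (typed_eta_closure G).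
  - exact (typed_hclosure _ typed_kappa G).
Qed.
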